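(* Let $A\in L^{\infty}(\mathfrak{S},\mathbb{R}^{n\times n};\mu)$ and $B\in L^{\infty}(\mathfrak{S},\mathbb{R}^{n\times m};\mu)$, and let $$G_T^\alpha:=\int_{0}^{T}(T-s)^{\alpha-1}\,\mathbb{E}\left(E_{\alpha,\alpha}((T-s)^{\alpha}A(\bullet))B(\bullet)\right)\,\mathbb{E}\left(B(\bullet)^{\top}E_{\alpha,\alpha}((T-s)^{\alpha}A(\bullet)^{\top})\right)ds\in\mathbb{R}^{n\times n}.$$ The system $\partial_t^\alpha x_\sigma(t)=A(\sigma)x_\sigma(t)+B(\sigma)u(t)$, $x_\sigma(0)=x_{0,\sigma}$, is exactly controllable in average in time $T$ if and only if $G_T^\alpha$ is invertible. Moreover, in this case, for any $x_{0,\bullet}\in L^1(\mathfrak{S},H;\mu)$ and $x_1\in H$, the control $$\hat u(t)=\mathbb{E}\left(B(\bullet)^{\top}E_{\alpha,\alpha}((T-t)^{\alpha}A(\bullet)^{\top})\right)(G_T^\alpha)^{-1}\left(x_1-\mathbb{E}\left(E_\alpha(T^{\alpha}A(\bullet))x_{0,\bullet}\right)\right)$$ satisfies $\mathbb{E}(x_\bullet(T;x_{0,\bullet};\hat u))=x_1$.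
   Context: Setting: $\alpha\in(0,1)$, $T>0$, $n,m\ge 1$, $H=\mathbb{R}^n$ and $U=\mathbb{R}^m$ with their Euclidean structures, $(\mathfrak{S},\mathcal{F},\mu)$ is a probability space, and $\mathbb{E}(f)=\int_{\mathfrak{S}}f(\sigma)\,d\mu(\sigma)$ for vector- or matrix-valued $f$ (entrywise). For a square matrix $M$, $E_\alpha(M)=\sum_{k=0}^\infty \frac{M^k}{\Gamma(\alpha k+1)}$ and $E_{\alpha,\alpha}(M)=\sum_{k=0}^\infty \frac{M^k}{\Gamma(\alpha k+\alpha)}$. Here $\partial_t^\alpha$ is the left Caputo derivative $\partial_t^\alpha g(t)=\frac{1}{\Gamma(1-\alpha)}\int_0^t (t-s)^{-\alpha}g'(s)\,ds$. For $x_{0,\sigma}\in H$ and $u\in L^\infty(0,T;U)$ (with $u$ independent of $\sigma$) the solution of the system is, for $\mu$-a.e. $\sigma$ and $t\in[0,T]$, $$x_\sigma(t;x_{0,\sigma};u)=E_\alpha(t^\alpha A(\sigma))x_{0,\sigma}+\int_0^t (t-s)^{\alpha-1}E_{\alpha,\alpha}((t-s)^\alpha A(\sigma))B(\sigma)u(s)\,ds.$$ The system is exactly controllable in average in time $T$ if for every $x_{0,\bullet}\in L^1(\mathfrak{S},H;\mu)$ and every $x_1\in H$ there exists $u\in L^\infty(0,T;U)$ such that $\mathbb{E}(x_\bullet(T;x_{0,\bullet};u))=x_1$. *)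

(* Defs.v *)
From mathcomp Require Import all_boot all_order all_algebra.
From mathcomp Require Import all_classical all_reals all_analysis.

Set Implicit Arguments.
Unset Strict Implicit.
Unset Printing Implicit Defensive.

Import Order.TTheory GRing.Theory Num.Theory.
Import numFieldNormedType.Exports.

Local Open Scope classical_set_scope.
Local Open Scope ring_scope.

Definition mx_integral d (X : measurableType d) (R : realType)
    (mu : {measure set X -> \bar R}) (D : set X) (p q : nat)
    (f : X -> 'M[R]_(p, q)) : 'M[R]_(p, q) :=
  \matrix_(i, j) (\int[mu]_(x in D) f x i j)%R.

(* L^r(D; mu) for matrix-valued functions, entrywise: since the matrix spaces
   are finite-dimensional, this is the usual space for any choice of norm. *)
Definition mx_Lfun d (X : measurableType d) (R : realType)
    (mu : {measure set X -> \bar R}) (r : \bar R) (D : set X) (p q : nat)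
    (f : X -> 'M[R]_(p, q)) : Prop :=
  forall i j, (fun x => f x i j) \_ D \in Lfun mu r.

Definition expect d (S : measurableType d) (R : realType)
    (mu : probability S R) (p q : nat) (f : S -> 'M[R]_(p, q)) : 'M[R]_(p, q) :=
  mx_integral mu setT f.

Definition Gamma (R : realType) (x : R) : R :=
  (\int[@lebesgue_measure R]_(t in `]0, +oo[) (t `^ (x - 1) * expR (- t)))%R.

(* E_(a,b)(M) = \sum_k M^k / Gamma (a k + b); E_a is E_(a,1). *)
Definition mittag_leffler (R : realType) (a b : R) (n : nat)
    (M : 'M[R]_n) : 'M[R]_n :=
  limn (series (fun k => (Gamma (a * k%:R + b))^-1 *: M ^+ k)).

Section FractionalSystem.
Context d (S : measurableType d) (R : realType) (mu : probability S R).
Context (n m : nat) (alpha T : R).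
Context (A : S -> 'M[R]_n) (B : S -> 'M[R]_(n, m)).

(* The solution of D_t^alpha x = A x + B u, x(0) = x0 (left Caputo derivative
   of order alpha), given by the variation-of-constants formula. *)
Definition solution (x0 : S -> 'cV[R]_n) (u : R -> 'cV[R]_m)
    (s : S) (t : R) : 'cV[R]_n :=
  mittag_leffler alpha 1 (t `^ alpha *: A s) *m x0 s +
  mx_integral (@lebesgue_measure R) `[0, t] (fun r =>
    (t - r) `^ (alpha - 1) *:
      (mittag_leffler alpha alpha ((t - r) `^ alpha *: A s) *m B s *m u r)).

Definition admissible_control (u : R -> 'cV[R]_m) : Prop :=
  mx_Lfun (@lebesgue_measure R) +oo%E `]0, T[ u.

Definition exactly_controllable_in_average : Prop :=
  forall (x0 : S -> 'cV[R]_n) (x1 : 'cV[R]_n), mx_Lfun mu 1%E setT x0 ->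
    exists2 u : R -> 'cV[R]_m,
      admissible_control u & expect mu (fun s => solution x0 u s T) = x1.

Definition average_gramian : 'M[R]_n :=
  mx_integral (@lebesgue_measure R) `[0, T] (fun r =>
    (T - r) `^ (alpha - 1) *:
      (expect mu (fun s =>
         mittag_leffler alpha alpha ((T - r) `^ alpha *: A s) *m B s) *m
       expect mu (fun s =>
         (B s)^T *m mittag_leffler alpha alpha ((T - r) `^ alpha *: (A s)^T)))).

Definition average_control (x0 : S -> 'cV[R]_n) (x1 : 'cV[R]_n)
    (t : R) : 'cV[R]_m :=
  expect mu (fun s =>
    (B s)^T *m mittag_leffler alpha alpha ((T - t) `^ alpha *: (A s)^T)) *m
  invmx average_gramian *m
  (x1 - expect mu (fun s =>
          mittag_leffler alpha 1 (T `^ alpha *: A s) *m x0 s)).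

End FractionalSystem.

(* Main.v *)
(* By Fubini, a deterministic control u enters the average of x(T) only through the
   averaged kernel K(r) = E(E_(a,a)((T - r)^a A) B), and the average of x(T) is
   E(E_a(T^a A) x0) + int_0^T w K u with w(r) = (T - r)^(a - 1); the Gramian is
   G = int_0^T w K K^T. If G is invertible, u = K^T G^-1 y contributes exactly y.
   If v G = 0 with v != 0, then int_0^T w |v K|^2 = 0, so v K = 0 almost everywhere
   and no control can move the average in the direction v. *)
Require Import Defs.
From mathcomp Require Import all_boot all_order all_algebra.
From mathcomp Require Import all_classical all_reals all_analysis.
From mathcomp Require Import measurable_realfun ess_sup_inf.

Set Implicit Arguments.
Unset Strict Implicit.
Unset Printing Implicit Defensive.

Import Order.TTheory GRing.Theory Num.Theory.
Import numFieldNormedType.Exports.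

Local Open Scope classical_set_scope.
Local Open Scope ring_scope.

(** * Mittag-Leffler functions of matrices *)

(** The exchange of expectation and time integral shapes the proof. The weight is singular at T,
    while [A], [B] and [u] are only essentially bounded, so the integrand is split into an
    integrable function of time (weight times control, cut off to (0, T)) and the response
    E_(a,a)((T - r)^a A) B, which is bounded outside a null set of parameters that does not depend
    on r. This bound reduces to a scalar one: if the entries of M are at most K, those of M^k are at
    most (n K)^k, so a matrix Mittag-Leffler function is dominated by the scalar series at n K. That
    series converges because 1 / Gamma(a k + b) decays faster than any geometric sequence, as one
    sees by restricting the Gamma integral to [L, L + 1] with L free. Limits and integrals are total
    and return default values on divergence, so each of them has to be shown genuine before it is
    manipulated. *)

Lemma mx_cvg (R : realType) (p q : nat) (f : nat -> 'M[R]_(p, q)) (M : 'M[R]_(p, q)) :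
  (forall i j, f k i j @[k --> \oo] --> M i j) -> f @ \oo --> M.
Proof.
move=> fM; apply/(@cvg_mx_entourageP R) => E entE.
have H (ij : 'I_p * 'I_q) : \forall k \near \oo, (M ij.1 ij.2, f k ij.1 ij.2) \in E.
  apply: (@filterS _ \oo _ [set k | xsection E (M ij.1 ij.2) (f k ij.1 ij.2)]).
    by move=> k /= /xsectionP Ek; rewrite inE.
  exact/(fM ij.1 ij.2)/nbhs_entourage.
have : \forall k \near \oo, forall ij : 'I_p * 'I_q,
  (M ij.1 ij.2, f k ij.1 ij.2) \in E by exact: filter_forall.
by apply: filterS => k kE i j; exact: (kE (i, j)).
Qed.

Lemma limn_mxE (R : realType) (p q : nat) (f : nat -> 'M[R]_(p, q)) :
  (forall i j, cvgn (fun k => f k i j)) ->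
  forall i j, (limn f) i j = limn (fun k => f k i j).
Proof.
move=> cf i j.
have -> : limn f = \matrix_(i, j) limn (fun k => f k i j).
  apply: (@cvg_lim _ (@norm_hausdorff _ _)); apply: mx_cvg => k l.
  by rewrite mxE; exact: cf.
by rewrite mxE.
Qed.

Lemma Gamma_ge0 (R : realType) (x : R) : 0 <= Gamma x.
Proof. by apply: Rintegral_ge0 => t _; rewrite mulr_ge0 ?powR_ge0 ?expR_ge0. Qed.

Lemma measurable_Gamma_integrand (R : realType) (x : R) :
  measurable_fun setT (fun t : R => t `^ (x - 1) * expR (- t)).
Proof.
apply: measurable_funM; first exact: measurable_powR.
by apply: measurableT_comp => //; exact: oppr_measurable.
Qed.

(* No integrability is needed: if the integral diverges then [Gamma x] is the junk
   value 0, and so is its inverse. *)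
Lemma invr_Gamma_le (R : realType) (x L : R) : 1 <= x -> 1 <= L ->
  (Gamma x)^-1 <= expR (L + 1) * L `^ (1 - x).
Proof.
move=> x1 L1; have L0 : 0 < L := lt_le_trans ltr01 L1.
have c0 : 0 < L `^ (x - 1) * expR (- (L + 1)) by rewrite mulr_gt0 ?powR_gt0 ?expR_gt0.
have [->|G0] := eqVneq (Gamma x) 0.
  by rewrite invr0 mulr_ge0 ?expR_ge0 ?powR_ge0.
have cE : expR (L + 1) * L `^ (1 - x) = (L `^ (x - 1) * expR (- (L + 1)))^-1.
  by rewrite -opprB powRN expRN invfM invrK mulrC.
rewrite cE lef_pV2 ?posrE ?lt_def ?G0 ?Gamma_ge0 ?c0//; last first.
  by rewrite gt_eqF ?ltW.
rewrite /Gamma /Rintegral.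
have mh : measurable_fun setT (fun t : R => (t `^ (x - 1) * expR (- t))%:E).
  by apply/measurable_EFinP; exact: measurable_Gamma_integrand.
set I := (X in fine X).
have Ifin : I \is a fin_num.
  by move: G0; rewrite /Gamma /Rintegral -/I; case: I => //=; rewrite eqxx.
rewrite -lee_fin fineK//.
(* On the unit interval [L, L + 1] the factor t^(x-1) is smallest at the left end, since x >= 1, and
   e^(-t) at the right end; the product of these two values bounds the Gamma integral from below. *)
apply: (@le_trans _ _ (\int[lebesgue_measure]_(t in `[L, (L + 1)%R])
    (t `^ (x - 1) * expR (- t))%:E)%E).
  apply: (@le_trans _ _ (\int[lebesgue_measure]_(t in `[L, (L + 1)%R])
      (L `^ (x - 1) * expR (- (L + 1)))%:E)%E).
    rewrite integral_cst//= lebesgue_measure_itv/= lte_fin ltrDl ltr01.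
    by rewrite -EFinD addrAC subrr add0r mule1.
  apply: ge0_le_integral => //=.
  - by move=> t _; rewrite lee_fin mulr_ge0 ?powR_ge0 ?expR_ge0.
  - exact: measurable_funS mh.
  move=> t /=; rewrite in_itv/= => /andP[Lt tL]; rewrite lee_fin.
  rewrite ler_pM ?powR_ge0 ?expR_ge0//.
    by rewrite ge0_ler_powR ?nnegrE ?subr_ge0// ?ltW// (lt_le_trans L0).
  by rewrite ler_expR lerN2.
apply: ge0_subset_integral => //=.
- exact: measurable_funS mh.
- by move=> t _; rewrite lee_fin mulr_ge0 ?powR_ge0 ?expR_ge0.
- by move=> t /=; rewrite !in_itv/= andbT => /andP[Lt _]; exact: lt_le_trans Lt.
Qed.

(* Taking [invr_Gamma_le] with L ^ a >= 2 K makes the terms O(2 ^ -k). *)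
Lemma is_cvg_series_mittag_leffler (R : realType) (a b K : R) : 0 < a -> 0 <= K ->
  cvgn (series (fun k => (Gamma (a * k%:R + b))^-1 * K ^+ k)).
Proof.
move=> a0 K0.
pose L := Num.max 1 ((2 * K) `^ a^-1).
have L1 : 1 <= L by rewrite /L le_max lexx.
have L0 : 0 < L := lt_le_trans ltr01 L1.
have LK : 2 * K <= L `^ a.
  have {1}-> : 2 * K = ((2 * K) `^ a^-1) `^ a.
    by rewrite -powRrM mulVf ?powRr1 ?mulr_ge0 ?lt0r_neq0.
  by rewrite ge0_ler_powR ?nnegrE ?powR_ge0 ?(ltW a0) ?(ltW L0)// /L le_max lexx orbT.
pose C := expR (L + 1) * L `^ (1 - b).
(* [invr_Gamma_le] applies only when the Gamma argument is at least 1, that is, from some rank [N]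
   on. *)
have [N HN] : exists N : nat, forall k, (N <= k)%N -> 1 <= a * k%:R + b.
  exists (Num.bound `|(1 - b) / a|) => k Nk.
  rewrite -lerBlDr mulrC -ler_pdivrMr// (le_trans (ler_norm _))//.
  by rewrite (le_trans (ltW (archi_boundP (normr_ge0 _))))// ler_nat.
pose u k := (Gamma (a * k%:R + b))^-1 * K ^+ k.
have u0 k : 0 <= u k by rewrite mulr_ge0 ?invr_ge0 ?Gamma_ge0// exprn_ge0.
(* The added sum absorbs the finitely many terms below rank [N], so that u k <= C' 2^(-k) holds for
   every k. *)
pose C' := C + \sum_(k < N) u k * 2 ^+ k.
have C0 : 0 <= C by rewrite mulr_ge0 ?expR_ge0 ?powR_ge0.
have C'0 : 0 <= C' by rewrite addr_ge0 ?sumr_ge0// => k _; rewrite mulr_ge0 ?exprn_ge0.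
apply: (@series_le_cvg _ u (geometric C' 2^-1)) => // [k|k|].
- by rewrite /= mulr_ge0 ?exprn_ge0.
- rewrite /= exprVn ler_pdivlMr ?exprn_gt0//.
  have [kN|Nk] := ltnP k N.
    rewrite /C' (bigD1 (Ordinal kN))//= addrCA lerDl addr_ge0 ?sumr_ge0// => i _.
    by rewrite mulr_ge0 ?exprn_ge0.
  rewrite /C' (@le_trans _ _ C)// ?lerDl ?sumr_ge0//; last first.
    by move=> i _; rewrite mulr_ge0 ?exprn_ge0.
  rewrite /u -mulrA -exprMn mulrC -[K * 2]mulrC.
  (* Here (2 K)^k <= L^(a k), and in L^(a k) L^(1 - (a k + b)) the dependence on k cancels, leaving
     exactly [C]. *)
  apply: (@le_trans _ _ ((L `^ a) ^+ k * (expR (L + 1) * L `^ (1 - (a * k%:R + b))))).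
    rewrite ler_pM ?exprn_ge0 ?mulr_ge0 ?invr_ge0 ?Gamma_ge0//.
      by rewrite lerXn2r ?nnegrE ?mulr_ge0 ?powR_ge0.
    exact: invr_Gamma_le (HN _ Nk) L1.
  rewrite -powR_mulrn ?powR_ge0// -powRrM mulrCA -powRD; last first.
    by rewrite (gt_eqF L0) implybT.
  by rewrite addrCA opprD addNKr.
- apply: is_cvg_geometric_series; rewrite ger0_norm// invf_lt1 ?ltr1n//.
Qed.

Lemma mx_exprE_le (R : realType) (n : nat) (M : 'M[R]_n) (K : R) :
  (forall i j, `|M i j| <= K) -> forall k i j, `|(M ^+ k) i j| <= (n%:R * K) ^+ k.
Proof.
move=> MK; elim=> [|k IH] i j.
  by rewrite !expr0 mxE; case: (i == j); rewrite ?normr1 ?normr0.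
rewrite !exprS mxE (le_trans (ler_norm_sum _ _ _))//.
apply: (@le_trans _ _ (\sum_(l < n) K * (n%:R * K) ^+ k)).
  by apply: ler_sum => l _; rewrite normrM ler_pM.
by rewrite sumr_const card_ord -mulrA [leRHS]mulr_natl.
Qed.

Section mittag_leffler_theory.
Context (R : realType) (n : nat) (a b : R).
Hypothesis a0 : 0 < a.

Let c k := (Gamma (a * k%:R + b))^-1.

Let c0 k : 0 <= c k. Proof. by rewrite invr_ge0 Gamma_ge0. Qed.

(** Absolute convergence of each entry, by comparison with the scalar series at n times the largest
    entry of [M], makes the matrix limit genuine. Bounds, transposition and measurability are then
    proved one entry at a time. *)
Lemma mittag_leffler_entry (M : 'M[R]_n) i j :
  (fun N => series (fun k => (Gamma (a * k%:R + b))^-1 * (M ^+ k) i j) N) @ \oo -->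
  mittag_leffler a b M i j.
Proof.
pose K := \big[Num.max/0]_(ij : 'I_n * 'I_n) `|M ij.1 ij.2|.
have MK k l : `|M k l| <= K by exact: (le_bigmax _ (fun ij => `|M ij.1 ij.2|) (k, l)).
have K0 : 0 <= K by exact: bigmax_ge_id.
have cv k l : cvgn (series (fun N => c N * (M ^+ N) k l)).
  apply: normed_cvg.
  apply: (@series_le_cvg _ _ (fun N => c N * (n%:R * K) ^+ N)) => [N|N|N|].
  - exact: normr_ge0.
  - by rewrite mulr_ge0 ?exprn_ge0 ?mulr_ge0.
  - by rewrite /= normrM ger0_norm// ler_wpM2l// mx_exprE_le.
  - by apply: is_cvg_series_mittag_leffler; rewrite ?mulr_ge0.
have sE k l : (fun N => series (fun p => c p *: M ^+ p) N k l) =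
    series (fun p => c p * (M ^+ p) k l).
  by apply/funext => N; rewrite /series/= summxE; apply: eq_bigr => p _; rewrite mxE.
rewrite /mittag_leffler limn_mxE; last by move=> k l; rewrite sE; exact: cv.
rewrite sE; exact: cv.
Qed.

(** The constant is the scalar series at n K, hence uniform over all such matrices; this turns an
    essential bound on [A] into one on the response. *)
Lemma mittag_leffler_le (K : R) : 0 <= K ->
  exists C : R, forall M : 'M[R]_n, (forall i j, `|M i j| <= K) ->
    forall i j, `|mittag_leffler a b M i j| <= C.
Proof.
move=> K0; exists (limn (series (fun k => c k * (n%:R * K) ^+ k))) => M MK i j.
have cK : cvgn (series (fun k => c k * (n%:R * K) ^+ k)).
  by apply: is_cvg_series_mittag_leffler; rewrite ?mulr_ge0.
have /cvg_norm cM := @mittag_leffler_entry M i j.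
rewrite -(cvg_lim _ cM)//; apply: ler_lim => //; first exact: cvgP cM.
near=> N; rewrite /series/= (le_trans (ler_norm_sum _ _ _))//.
by apply: ler_sum => k _; rewrite normrM (ger0_norm (c0 k)) ler_wpM2l// mx_exprE_le.
Unshelve. all: by end_near. Qed.

Lemma trmx_mittag_leffler (M : 'M[R]_n) :
  (mittag_leffler a b M)^T = mittag_leffler a b M^T.
Proof.
apply/matrixP => i j; rewrite mxE.
apply: (@cvg_unique _ (@Rhausdorff R) _ _ _ _ _ (@mittag_leffler_entry M^T i j)).
have trX k : M^T ^+ k = (M ^+ k)^T.
  by elim: k => [|k IH]; rewrite ?expr0 ?trmx1// exprS IH exprSr trmx_mul.
rewrite (_ : (fun N => _) = fun N =>
    series (fun k => (Gamma (a * k%:R + b))^-1 * (M ^+ k) j i) N).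
  exact: mittag_leffler_entry.
by apply/funext => N; apply: eq_bigr => k _; rewrite trX mxE.
Qed.

Lemma measurable_mittag_leffler d (Z : measurableType d) (X : Z -> 'M[R]_n) :
  (forall i j, measurable_fun setT (fun z => X z i j)) ->
  forall i j, measurable_fun setT (fun z => mittag_leffler a b (X z) i j).
Proof.
move=> mX i j.
apply: (@measurable_fun_cvg _ _ _ _
  (fun N z => series (fun k => c k * (X z ^+ k) i j) N)); last first.
  by move=> z _; exact: mittag_leffler_entry.
have mXk k : forall i j, measurable_fun setT (fun z => (X z ^+ k) i j).
  elim: k => [|k IH] k' l; first by under eq_fun do rewrite expr0; exact: measurable_cst.
  under eq_fun do rewrite exprS mxE.
  by apply: measurable_sum => p; exact: measurable_funM.
by move=> N; apply: measurable_sum => k; apply: measurable_funM.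
Qed.

End mittag_leffler_theory.

(** * Matrix-valued integrals and Fubini *)

Section mx_integral_theory.
Context d (X : measurableType d) (R : realType) (mu : {measure set X -> \bar R}).
Context (D : set X) (mD : measurable D).

Definition mx_integrable (p q : nat) (f : X -> 'M[R]_(p, q)) : Prop :=
  forall i j, mu.-integrable D (fun x => (f x i j)%:E).

Lemma integrable_sumr (I : Type) (s : seq I) (h : I -> X -> R) :
  (forall i, mu.-integrable D (fun x => (h i x)%:E)) ->
  mu.-integrable D (fun x => (\sum_(i <- s) h i x)%:E).
Proof.
move=> ih; under eq_fun do rewrite -sumEFin.
exact: integrable_sum.
Qed.

Lemma Rintegral_sum (I : Type) (s : seq I) (h : I -> X -> R) :
  (forall i, mu.-integrable D (fun x => (h i x)%:E)) ->
  \int[mu]_(x in D) (\sum_(i <- s) h i x) = \sum_(i <- s) \int[mu]_(x in D) h i x.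
Proof.
move=> ih; elim: s => [|i s IH].
  under eq_Rintegral do rewrite big_nil.
  by rewrite big_nil Rintegral_cst// mul0r.
under eq_Rintegral do rewrite big_cons.
rewrite RintegralD; [|exact: mD|exact: ih|exact: integrable_sumr].
by rewrite IH big_cons.
Qed.

Lemma integrable_mull (c : R) (h : X -> R) : mu.-integrable D (fun x => (h x)%:E) ->
  mu.-integrable D (fun x => (c * h x)%:E).
Proof. by move=> ih; under eq_fun do rewrite EFinM; exact: integrableZl. Qed.

Lemma integrable_mulr (c : R) (h : X -> R) : mu.-integrable D (fun x => (h x)%:E) ->
  mu.-integrable D (fun x => (h x * c)%:E).
Proof. by move=> ih; under eq_fun do rewrite mulrC; exact: integrable_mull. Qed.

Lemma mx_integrable_mull (p q r : nat) (M : 'M[R]_(p, q)) (f : X -> 'M[R]_(q, r)) :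
  mx_integrable f -> mx_integrable (fun x => M *m f x).
Proof.
move=> fi i j; under eq_fun do rewrite mxE.
by apply: integrable_sumr => k; exact: integrable_mull.
Qed.

Lemma mx_integral_mull (p q r : nat) (M : 'M[R]_(p, q)) (f : X -> 'M[R]_(q, r)) :
  mx_integrable f -> mx_integral mu D (fun x => M *m f x) = M *m mx_integral mu D f.
Proof.
move=> fi; apply/matrixP => i j; rewrite !mxE.
under eq_Rintegral do rewrite mxE.
rewrite Rintegral_sum; last by move=> k; exact: integrable_mull.
by apply: eq_bigr => k _; rewrite RintegralZl ?mxE//; exact: fi.
Qed.

Lemma mx_integral_mulr (p q r : nat) (M : 'M[R]_(q, r)) (f : X -> 'M[R]_(p, q)) :
  mx_integrable f -> mx_integral mu D (fun x => f x *m M) = mx_integral mu D f *m M.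
Proof.
move=> fi; apply/matrixP => i j; rewrite !mxE.
under eq_Rintegral do rewrite mxE.
rewrite Rintegral_sum; last by move=> k; exact: integrable_mulr.
by apply: eq_bigr => k _; rewrite RintegralZr ?mxE//; exact: fi.
Qed.

Lemma mx_integralD (p q : nat) (f g : X -> 'M[R]_(p, q)) :
  mx_integrable f -> mx_integrable g ->
  mx_integral mu D (fun x => f x + g x) = mx_integral mu D f + mx_integral mu D g.
Proof.
move=> fi gi; apply/matrixP => i j; rewrite !mxE.
under eq_Rintegral do rewrite mxE.
by rewrite RintegralD; [|exact: mD|exact: fi|exact: gi].
Qed.

Lemma trmx_mx_integral (p q : nat) (f : X -> 'M[R]_(p, q)) :
  (mx_integral mu D f)^T = mx_integral mu D (fun x => (f x)^T).
Proof.
by apply/matrixP => i j; rewrite !mxE; apply: eq_Rintegral => x _; rewrite mxE.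
Qed.

End mx_integral_theory.

Lemma integral_cst_probability d (S : measurableType d) (R : realType)
    (mu : probability S R) (c : \bar R) : (\int[mu]_s c = c)%E.
Proof. by rewrite integral_cst// [X in (_ * X)%E](probability_setT mu) mule1. Qed.

(** * Fubini for real-valued integrals, and integrability on the product *)

Section Rintegral_fubini.
Context d1 d2 (S : measurableType d1) (X : measurableType d2) (R : realType).
Context (m1 : {sigma_finite_measure set S -> \bar R}).
Context (m2 : {sigma_finite_measure set X -> \bar R}).
Context (f : S * X -> R).
Hypothesis fi : (m1 \x m2)%E.-integrable setT (EFin \o f).

(** A real-valued inner integral is [fine] of the extended one, which may be infinite or undefined
    on a null set of slices; the two agree only almost everywhere, and this is enough to transfer
    Fubini. *)
Let ae_fine_l : {ae m1, forall s, setT s ->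
  (fubini_F m2 (EFin \o f) s = (\int[m2]_x f (s, x))%:E)%E}.
Proof.
have := ae_integrable1 fi.
by apply: filterS => s /= fs _; rewrite /Rintegral fineK// integrable_fin_num.
Qed.

Let ae_fine_r : {ae m2, forall x, setT x ->
  (fubini_G m1 (EFin \o f) x = (\int[m1]_s f (s, x))%:E)%E}.
Proof.
have := ae_integrable2 fi.
by apply: filterS => x /= fx _; rewrite /Rintegral fineK// integrable_fin_num.
Qed.

Let measurable_l : measurable_fun setT (fun s => (\int[m2]_x f (s, x))%:E).
Proof.
apply/measurable_EFinP.
apply: (@measurableT_comp _ _ _ _ _ _ fine _ (fubini_F m2 (EFin \o f))).
  exact: fine_measurable.
exact: measurable_fubini_F fi.
Qed.

Let measurable_r : measurable_fun setT (fun x => (\int[m1]_s f (s, x))%:E).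
Proof.
apply/measurable_EFinP.
apply: (@measurableT_comp _ _ _ _ _ _ fine _ (fubini_G m1 (EFin \o f))).
  exact: fine_measurable.
exact: measurable_fubini_G fi.
Qed.

Lemma integrable_Rintegral : m1.-integrable setT (fun s => (\int[m2]_x f (s, x))%:E).
Proof.
have /integrableP[mF Ffin] := integrable_fubini_F fi.
apply/integrableP; split => //; apply: le_lt_trans Ffin.
rewrite le_eqVlt; apply/orP; left; apply/eqP; apply: ge0_ae_eq_integral => //.
- exact: measurableT_comp.
- exact: measurableT_comp.
- by apply: filterS ae_fine_l => s h _; rewrite h.
Qed.

Lemma Rintegral_swap : \int[m1]_s \int[m2]_x f (s, x) = \int[m2]_x \int[m1]_s f (s, x).
Proof.
congr fine.
transitivity (\int[m1]_s fubini_F m2 (EFin \o f) s)%E.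
  apply: ae_eq_integral => //; first exact: measurable_fubini_F fi.
  by apply: filterS ae_fine_l => s h _; rewrite h.
rewrite (Fubini fi).
apply: ae_eq_integral => //; exact: measurable_fubini_G fi.
Qed.

End Rintegral_fubini.

Section bounded_integrand.
Context d1 d2 (S : measurableType d1) (X : measurableType d2) (R : realType).
Context (mu : probability S R) (m2 : {sigma_finite_measure set X -> \bar R}).
Context (g : X -> R) (phi : S * X -> R) (C : R).
Hypothesis mphi : measurable_fun setT phi.
Hypothesis phiC : {ae mu, forall s, forall x, g x != 0 -> `|phi (s, x)| <= C}.

(** Tonelli with the probability integral innermost: the slice at x contributes at most |C| |g x|,
    as [mu] has mass 1. The bound [phiC] is restricted to the support of [g] because the response is
    controlled only at times in (0, T), outside which [g] will vanish. *)
Lemma integrable_prod_bounded : m2.-integrable setT (EFin \o g) ->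
  (mu \x m2)%E.-integrable setT (fun z => (g z.2 * phi z)%:E).
Proof.
move=> ig; pose f (z : S * X) := (g z.2 * phi z)%:E.
have mf : measurable_fun setT f.
  apply/measurable_EFinP; apply: measurable_funM => //.
  have /measurable_EFinP mg := measurable_int _ ig.
  exact: measurableT_comp.
apply/integrable21ltyP => //.
have igC : m2.-integrable setT (fun x => (`|C| * g x)%:E) by exact: integrable_mull.
move: (igC) => /integrableP[mgC]; apply: le_lt_trans.
apply: ge0_le_integral => //.
- by move=> x _; exact: integral_ge0.
- apply: (measurable_fun_fubini_tonelli_G (abse \o f)) => //=.
  exact: measurableT_comp.
- exact: measurableT_comp.
move=> x _.
have -> : `|(`|C| * g x)%:E|%E = (\int[mu]_s `|(`|C| * g x)%:E|%E)%E.
  by rewrite integral_cst_probability.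
apply: ae_ge0_le_integral => //.
- by apply: measurableT_comp => //; exact: (measurableT_comp mf (pair2_measurable x)).
apply: filterS phiC => s phis _; rewrite /f/= lee_fin mulrC !normrM normr_id.
have [->|gx] := eqVneq (g x) 0; first by rewrite normr0 !mulr0.
by rewrite ler_wpM2r// (le_trans (phis x gx))// ler_norm.
Qed.

End bounded_integrand.

(** The slices may fail to be integrable, so measurability comes from Tonelli applied to the
    positive and negative parts, followed by [fine]. *)
Lemma measurable_Rintegral_r d1 d2 (X : measurableType d1) (S : measurableType d2)
    (R : realType) (mu : probability S R) (phi : S * X -> R) :
  measurable_fun setT phi -> measurable_fun setT (fun x => \int[mu]_s phi (s, x)).
Proof.
move=> mphi; apply: (@measurableT_comp _ _ _ _ _ _ fine _
  (fun x => \int[mu]_s (phi (s, x))%:E)%E).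
  exact: fine_measurable.
have mE : measurable_fun setT (EFin \o phi) by exact/measurable_EFinP.
rewrite (_ : (fun x => _) =
  fubini_G mu (EFin \o phi)^\+ \- fubini_G mu (EFin \o phi)^\-)%E.
  apply: emeasurable_funB.
    exact: measurable_fun_fubini_tonelli_G (measurable_funepos mE) (funepos_ge0 _).
  exact: measurable_fun_fubini_tonelli_G (measurable_funeneg mE) (funeneg_ge0 _).
apply/funext => x; rewrite [LHS]integralE.
under eq_integral do rewrite (@funepos_comp _ _ _ (EFin \o phi) (fun s => (s, x)))/=.
by under [X in (_ - X)%E]eq_integral do
  rewrite (@funeneg_comp _ _ _ (EFin \o phi) (fun s => (s, x)))/=.
Qed.

Lemma integrableM_ae_bounded d (X : measurableType d) (R : realType)
    (mu : {measure set X -> \bar R}) (D : set X) (g h : X -> R) (C : R) :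
  measurable D -> mu.-integrable D (EFin \o g) -> measurable_fun D h ->
  {ae mu, forall x, D x -> `|h x| <= C} ->
  mu.-integrable D (fun x => (g x * h x)%:E).
Proof.
move=> mD ig mh hC.
have /measurable_EFinP mg := measurable_int _ ig.
have mgh : measurable_fun D (fun x => (g x * h x)%:E).
  by apply/measurable_EFinP; exact: measurable_funM.
have igC : mu.-integrable D (fun x => (`|C| * g x)%:E) by exact: integrable_mull.
move: (igC) => /integrableP[mgC gCy]; apply/integrableP; split => //.
apply: le_lt_trans gCy; apply: ae_ge0_le_integral => //.
- exact: measurableT_comp.
- exact: measurableT_comp.
apply: filterS hC => x hx Dx; rewrite /= lee_fin mulrC !normrM normr_id.
by rewrite ler_wpM2r// (le_trans (hx Dx))// ler_norm.
Qed.

Lemma bounded_integrable_probability d (S : measurableType d) (R : realType)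
    (mu : probability S R) (h : S -> R) (C : R) :
  measurable_fun setT h -> {ae mu, forall s, `|h s| <= C} ->
  mu.-integrable setT (EFin \o h).
Proof.
move=> mh hC.
have := @integrableM_ae_bounded _ _ _ mu setT (fun=> 1) h C measurableT.
under [in X in _ -> _ -> _ -> X]eq_fun do rewrite mul1r.
apply => //; last by apply: filterS hC.
exact: finite_measure_integrable_cst.
Qed.

(** * The weight and essential bounds *)

Lemma is_derive_powR_subr (R : realType) (T a x : R) : x < T ->
  is_derive x 1 (fun r => (T - r) `^ a) (- (a * (T - x) `^ (a - 1))).
Proof.
move=> xT.
have Tx : 0 < T - x by rewrite subr_gt0.
have d1 : is_derive x (1 : R) (fun r : R => T - r) (-1).
  by apply: is_derive_eq; rewrite add0r mul1r.
have d2 : is_derive (T - x) (1 : R) ((@powR R) ^~ a) (a * (T - x) `^ (a - 1)).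
  exact: is_derive1_powR.
have := @is_derive1_comp _ ((@powR R) ^~ a) (fun r => T - r) x _ _ d2 d1; rewrite mulrN1.
exact.
Qed.

(** For a < 1 the weight blows up at T, so the fundamental theorem of calculus is applied on
    intervals [0, c k] with c k < T. The integrals stay below T^a / a uniformly in k, and monotone
    convergence carries the bound to ]0, T[. *)
Lemma integrable_powR_subr (R : realType) (a T : R) : 0 < a -> 0 < T ->
  (@lebesgue_measure R).-integrable `]0, T[ (fun r => ((T - r) `^ (a - 1))%:E).
Proof.
move=> a0 T0.
pose w (r : R) := (T - r) `^ (a - 1).
pose F (r : R) := - a^-1 * (T - r) `^ a.
(* With [k.+2] rather than [k.+1], already c 0 = T / 2 is positive and no interval degenerates. *)
pose c (k : nat) := T - T / k.+2%:R.
have cT k : c k < T by rewrite /c ltrBlDr ltrDl divr_gt0.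
have c0 k : 0 < c k.
  by rewrite subr_gt0 ltr_pdivrMr// ltr_pMr// ltr1n.
have mw : measurable_fun setT (fun r => (w r)%:E).
  apply/measurable_EFinP; apply: (measurableT_comp (measurable_powR _)).
  by apply: measurable_funB.
have w0 r : (0 <= (w r)%:E)%E by rewrite lee_fin powR_ge0.
have dF x : x < T -> is_derive x 1 F (w x).
  move=> xT; have := is_deriveZ (- a^-1) (is_derive_powR_subr a xT).
  by rewrite /GRing.scale/= mulrNN mulrA mulVf ?mul1r ?gt_eqF.
have iS k : (\int[lebesgue_measure]_(r in `[0%R, c k]) (w r)%:E <= (T `^ a / a)%:E)%E.
  rewrite (@continuous_FTC2 _ w F)//.
  - rewrite -EFinB lee_fin /F !mulNr opprK subr0 addrC mulrC lerBlDr.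
    by rewrite lerDl mulr_ge0 ?invr_ge0 ?powR_ge0// ltW.
  - apply: derivable_within_continuous => x; rewrite in_itv/= => /andP[_ xc].
    by apply: ex_derive; apply: is_derive_powR_subr; exact: le_lt_trans (cT k).
  - have cF : {within `[0%R, c k], continuous F}.
      apply: derivable_within_continuous => x; rewrite in_itv/= => /andP[_ xc].
      by apply: ex_derive; apply: dF; exact: le_lt_trans (cT k).
    have /(continuous_within_itvP _ (c0 k))[_ F0 Fc] := cF.
    split => // x; rewrite in_itv/= => /andP[_ xc].
    by apply: ex_derive; apply: dF; exact: lt_trans (cT k).
  - move=> x; rewrite in_itv/= => /andP[_ xc]; rewrite derive1E.
    by apply: derive_val; apply: dF; exact: lt_trans (cT k).
apply/integrableP; split; first exact: measurable_funS mw.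
under eq_integral do rewrite (gee0_abs (w0 _)).
apply: (@le_lt_trans _ _ (T `^ a / a)%:E); last exact: ltry.
have nd : nondecreasing_seq (fun k => `[0%R, c k]%classic).
  apply/nondecreasing_seqP => k; rewrite subsetEset; apply: subset_itvl.
  rewrite bnd_simp lerD2l lerN2 ler_pM2l// lef_pV2 ?posrE ?ltr0n//.
  by rewrite ler_nat.
have cvg : (\int[lebesgue_measure]_(r in `[0%R, c k]) (w r)%:E @[k --> \oo] -->
    \int[lebesgue_measure]_(r in \bigcup_k `[0%R, c k]%classic) (w r)%:E)%E.
  apply: ge0_nondecreasing_set_cvg_integral => // k.
  exact: measurable_funS mw.
apply: (@le_trans _ _
  (\int[lebesgue_measure]_(r in \bigcup_k `[0%R, c k]%classic) (w r)%:E)%E).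
  apply: ge0_subset_integral => //.
  - by apply: bigcup_measurable => k _; exact: measurable_itv.
  - exact: measurable_funS mw.
  move=> r /=; rewrite in_itv/= => /andP[r0 rT].
  have Tr : 0 < T - r by rewrite subr_gt0.
  (* Once k >= T / (T - r), one has T / (k + 2) <= T - r, that is, r <= c k. *)
  exists (Num.bound (T / (T - r))) => //=; rewrite in_itv/= (ltW r0)/=.
  rewrite /c lerBrDl -lerBrDr ler_pdivrMr// -ler_pdivrMl// mulrC.
  have := archi_boundP (ltW (divr_gt0 T0 Tr)).
  move=> /ltW/le_trans; apply; rewrite ler_nat.
  exact: leqW (leqnSn _).
rewrite -(cvg_lim _ cvg)//; apply: lime_le; last exact: nearW.
by apply/cvg_ex; eexists; exact: cvg.
Qed.

Section essential_bounds.
Context d (X : measurableType d) (R : realType) (mu : {measure set X -> \bar R}).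
Implicit Types f : X -> R.

Lemma Lfun_measurable (p : \bar R) f : f \in Lfun mu p -> measurable_fun setT f.
Proof. by rewrite inE => /andP[/[!inE]]. Qed.

Lemma Lfuny_ae_bounded f : f \in Lfun mu +oo%E ->
  exists C : R, {ae mu, forall x, `|f x| <= C}.
Proof.
rewrite inE => /andP[_ /[!inE]/=]; rewrite /finite_norm unlock.
case: ifPn => [mu0 supy|].
  have sup0 : (0 <= ess_sup mu (abse \o (EFin \o f)))%E.
    by apply: ess_sup_gee => //; apply: nearW => x; exact: abse_ge0.
  exists (fine (ess_sup mu (abse \o (EFin \o f)))).
  have := ess_sup_ge mu (abse \o (EFin \o f)).
  apply: filterS => x; rewrite -[X in (_ <= X)%E]fineK ?ge0_fin_numE//.
(* When the space has measure zero the L^oo norm is 0 by convention and bounds nothing, but the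
   whole space is then an admissible exceptional set. *)
rewrite -leNgt => mu0 _; exists 0.
by exists setT; split => //; apply/eqP; rewrite eq_le mu0 measure_ge0.
Qed.

Lemma bounded_Lfuny f (C : R) : measurable_fun setT f ->
  (forall x, `|f x| <= C) -> f \in Lfun mu +oo%E.
Proof.
move=> mf fC; rewrite inE; apply/andP; split; rewrite inE//=.
rewrite /finite_norm unlock; case: ifPn => // mu0.
apply: (@le_lt_trans _ _ C%:E); last exact: ltry.
by apply/ess_supP; apply: nearW => x; rewrite /= lee_fin.
Qed.

End essential_bounds.

Section mx_Lfun_theory.
Context d (X : measurableType d) (R : realType) (mu : {measure set X -> \bar R}).
Context (D : set X) (mD : measurable D) (p q : nat) (f : X -> 'M[R]_(p, q)).

Lemma mx_Lfun_measurable (r : \bar R) : mx_Lfun mu r D f ->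
  forall i j, measurable_fun D (fun x => f x i j).
Proof.
by move=> fL i j; apply/(measurable_restrictT _ mD)/(Lfun_measurable (fL i j)).
Qed.

(** There are finitely many entries, so one constant and one null set serve them all. *)
Lemma mx_Lfuny_ae_bounded : mx_Lfun mu +oo%E D f ->
  exists C : R, {ae mu, forall x, D x -> forall i j, `|f x i j| <= C}.
Proof.
move=> fL.
have /choice[c cP] : forall ij : 'I_p * 'I_q, exists C : R,
    {ae mu, forall x, D x -> `|f x ij.1 ij.2| <= C}.
  move=> ij; have [C fC] := Lfuny_ae_bounded (fL ij.1 ij.2); exists C.
  by apply: filterS fC => x + Dx; rewrite patchE mem_set.
exists (\big[Num.max/0]_ij c ij).
apply: filterS (@filter_forall _ _ _ _ _ cP) => x fc Dx i j.
exact: le_trans (fc (i, j) Dx) (le_bigmax _ _ _).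
Qed.

Lemma bounded_mx_Lfuny (C : R) : (forall i j, measurable_fun D (fun x => f x i j)) ->
  (forall x, D x -> forall i j, `|f x i j| <= C) -> mx_Lfun mu +oo%E D f.
Proof.
move=> mf fC i j; apply: (@bounded_Lfuny _ _ _ _ _ `|C|).
  exact/(measurable_restrictT _ mD).
move=> x; rewrite patchE; case: ifPn => [/set_mem Dx|_]; last by rewrite normr0.
exact: le_trans (fC x Dx i j) (ler_norm _).
Qed.

End mx_Lfun_theory.

(** The solution and the Gramian integrate over [0, T], whereas an admissible control is constrained
    only on ]0, T[; the endpoints form a null set. *)
Lemma mx_integral_itv_ccoo (R : realType) (a b : R) (p q : nat) (f : R -> 'M[R]_(p, q)) :
  (forall i j, measurable_fun `]a, b[ (fun r => f r i j)) ->
  mx_integral (@lebesgue_measure R) `[a, b] f =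
  mx_integral (@lebesgue_measure R) `]a, b[ f.
Proof.
move=> mf; apply/matrixP => i j; rewrite !mxE /Rintegral.
by rewrite integral_itv_bndoo//; apply/measurable_EFinP; exact: mf.
Qed.

Lemma measurable_mulmx d (X : measurableType d) (R : realType) (D : set X)
    (p q r : nat) (f : X -> 'M[R]_(p, q)) (g : X -> 'M[R]_(q, r)) :
  (forall i j, measurable_fun D (fun x => f x i j)) ->
  (forall i j, measurable_fun D (fun x => g x i j)) ->
  forall i j, measurable_fun D (fun x => (f x *m g x) i j).
Proof.
move=> mf mg i j; under eq_fun do rewrite mxE.
by apply: measurable_sum => k; apply: measurable_funM; [exact: mf|exact: mg].
Qed.

Lemma mulmx_norm_le (R : realType) (p q r : nat) (M : 'M[R]_(p, q)) (N : 'M[R]_(q, r))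
    (a b : R) : (forall i j, `|M i j| <= a) -> (forall i j, `|N i j| <= b) ->
  forall i j, `|(M *m N) i j| <= q%:R * (a * b).
Proof.
move=> Ma Nb i j; rewrite mxE (le_trans (ler_norm_sum _ _ _))//.
apply: (@le_trans _ _ (\sum_(k < q) a * b)).
  by apply: ler_sum => k _; rewrite normrM ler_pM.
by rewrite sumr_const card_ord mulr_natl.
Qed.

(** * Averaged control *)

Section average_control_system.
Context (d : measure_display) (S : measurableType d) (R : realType)
    (mu : probability S R) (n m : nat) (alpha T : R)
    (A : S -> 'M[R]_n) (B : S -> 'M[R]_(n, m)).
Hypotheses (alpha0 : 0 < alpha) (T0 : 0 < T).
Hypotheses (hA : mx_Lfun mu +oo%E setT A) (hB : mx_Lfun mu +oo%E setT B).

Notation leb := (@lebesgue_measure R).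

Let w (r : R) : R := (T - r) `^ (alpha - 1).

(** The scalar weight is kept apart as [w]: it carries the whole singularity, and what remains is
    essentially bounded uniformly in time on (0, T). *)
Definition input_response (r : R) (s : S) : 'M[R]_(n, m) :=
  mittag_leffler alpha alpha ((T - r) `^ alpha *: A s) *m B s.

Definition average_response (r : R) : 'M[R]_(n, m) := expect mu (input_response r).

Notation Phi := input_response.
Notation K := average_response.

Lemma expect_mul_trmx_response r :
  expect mu (fun s => (B s)^T *m mittag_leffler alpha alpha ((T - r) `^ alpha *: (A s)^T)) =
  (K r)^T.
Proof.
rewrite trmx_mx_integral; congr mx_integral; apply/funext => s.
by rewrite /Phi trmx_mul trmx_mittag_leffler// linearZ.
Qed.

Let mA i j : measurable_fun setT (fun s => A s i j).
Proof. exact: mx_Lfun_measurable hA i j. Qed.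

Let mB i j : measurable_fun setT (fun s => B s i j).
Proof. exact: mx_Lfun_measurable hB i j. Qed.

Lemma measurable_input_response i j :
  measurable_fun setT (fun z : S * R => Phi z.2 z.1 i j).
Proof.
apply: measurable_mulmx => {}i {}j; last exact: (measurableT_comp (mB i j)).
apply: measurable_mittag_leffler => // k l; under eq_fun do rewrite mxE.
apply: measurable_funM; last exact: (measurableT_comp (mA k l)).
apply: (measurableT_comp (measurable_powR _)).
by apply: measurable_funB => //; exact: measurable_snd.
Qed.

(** The exceptional set comes from [A] alone, hence is the same for all r: outside it the entries of
    r^alpha A(s) stay below T^alpha |a| on the whole of [0, T]. *)
Lemma ae_mittag_leffler_bounded (b : R) : exists C : R, {ae mu, forall s, forall r : R,
  0 <= r <= T -> forall i j, `|mittag_leffler alpha b (r `^ alpha *: A s) i j| <= C}.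
Proof.
have [a hAa] := mx_Lfuny_ae_bounded hA.
have [C hC] := @mittag_leffler_le R n alpha b alpha0 (T `^ alpha * `|a|)
  (mulr_ge0 (powR_ge0 _ _) (normr_ge0 _)).
exists C; apply: filterS hAa => s As r /andP[r0 rT] i j; apply: hC => k l.
rewrite mxE normrM ger0_norm ?powR_ge0// ler_pM ?powR_ge0//.
  by rewrite ge0_ler_powR ?nnegrE// ltW.
exact: le_trans (As I k l) (ler_norm _).
Qed.

Lemma ae_input_response_bounded : exists C : R, {ae mu, forall s, forall r : R,
  0 < r < T -> forall i j, `|Phi r s i j| <= C}.
Proof.
have [a ha] := ae_mittag_leffler_bounded alpha.
have [b hb] := mx_Lfuny_ae_bounded hB.
exists (n%:R * (a * b)); apply: filterS2 ha hb => s sa sb r /andP[r0 rT].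
apply: mulmx_norm_le; last exact: sb.
by apply: sa; rewrite subr_ge0 (ltW rT) lerBlDr lerDl ltW.
Qed.

Lemma measurable_average_response i j : measurable_fun setT (fun r => K r i j).
Proof.
under eq_fun do rewrite mxE.
exact: measurable_Rintegral_r (measurable_input_response i j).
Qed.

Lemma integrable_input_response r i j : 0 < r < T ->
  mu.-integrable setT (fun s => (Phi r s i j)%:E).
Proof.
move=> rT; have [C hC] := ae_input_response_bounded.
apply: (@bounded_integrable_probability _ _ _ mu _ C).
  exact: (measurableT_comp (measurable_input_response i j) (pair2_measurable r)).
by apply: filterS hC => s /(_ r rT i j).
Qed.

Lemma average_response_bounded : exists C : R, forall r, 0 < r < T ->
  forall i j, `|K r i j| <= C.
Proof.
have [C hC] := ae_input_response_bounded; exists `|C| => r rT i j.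
rewrite mxE -lee_fin EFin_normr_Rintegral//; last exact: integrable_input_response.
have mP : measurable_fun setT (fun s => (Phi r s i j)%:E).
  exact: measurable_int (integrable_input_response _ _ rT).
rewrite (le_trans (le_abse_integral _ _ _))//.
rewrite -[leRHS](integral_cst_probability mu).
apply: ae_ge0_le_integral => //; first exact: measurableT_comp.
apply: filterS hC => s /(_ r rT i j) Ps _; rewrite lee_fin.
exact: le_trans Ps (ler_norm _).
Qed.

Let mD : @measurable _ (measurableTypeR R) `]0, T[. Proof. exact: measurable_itv. Qed.

Let iw : leb.-integrable `]0, T[ (fun r => (w r)%:E).
Proof. exact: integrable_powR_subr. Qed.

Lemma measurable_average_input (q : nat) (u : R -> 'M[R]_(m, q)) :
  (forall i j, measurable_fun `]0, T[ (fun r => u r i j)) ->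
  forall i j, measurable_fun `]0, T[ (fun r => (w r *: (K r *m u r)) i j).
Proof.
move=> meas_u i j; under [X in measurable_fun _ X]eq_fun do rewrite mxE.
apply: measurable_funM; first by apply/measurable_EFinP; exact: measurable_int iw.
apply: measurable_mulmx => // k l.
exact: measurable_funS (measurable_average_response k l).
Qed.

(** Several columns are allowed so that the lemma covers both a control (q = 1) and the factor K^T
    of the Gramian (q = n). *)
Lemma integrable_average_input (q : nat) (u : R -> 'M[R]_(m, q)) :
  mx_Lfun leb +oo%E `]0, T[ u ->
  mx_integrable leb `]0, T[ (fun r => w r *: (K r *m u r)).
Proof.
move=> hu i j /=; under [X in leb.-integrable _ X]eq_fun do rewrite mxE.
have meas_u := mx_Lfun_measurable mD hu.
have [a ha] := average_response_bounded.
have [b hb] := mx_Lfuny_ae_bounded hu.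
apply: (@integrableM_ae_bounded _ _ _ _ _ _ _ (m%:R * (a * b))) => //.
  apply: measurable_mulmx => // k l.
  exact: measurable_funS (measurable_average_response k l).
apply: filterS hb => r rb rD; apply: mulmx_norm_le; last exact: rb.
by apply: ha; move: rD; rewrite /= in_itv.
Qed.

Lemma integrable_free_response (x0 : S -> 'cV[R]_n) : mx_Lfun mu 1%E setT x0 ->
  mx_integrable mu setT (fun s => mittag_leffler alpha 1 (T `^ alpha *: A s) *m x0 s).
Proof.
move=> hx0 i j; under eq_fun do rewrite mxE.
apply: integrable_sumr => // k; under eq_fun do rewrite mulrC.
have [a ha] := ae_mittag_leffler_bounded 1.
apply: (@integrableM_ae_bounded _ _ _ _ _ _ _ a) => //.
- have /Lfun1_integrable := hx0 k j; rewrite patch_setT.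
  exact.
- apply: measurable_mittag_leffler => // {}i {}j; under eq_fun do rewrite mxE.
  exact: measurable_funM.
- by apply: filterS ha => s sa _; apply: sa; rewrite ltW/=.
Qed.

Lemma expect_solution (x0 : S -> 'cV[R]_n) (u : R -> 'cV[R]_m) :
  mx_Lfun mu 1%E setT x0 -> admissible_control T u ->
  expect mu (fun s => solution alpha A B x0 u s T) =
  expect mu (fun s => mittag_leffler alpha 1 (T `^ alpha *: A s) *m x0 s) +
  mx_integral leb `]0, T[ (fun r => w r *: (K r *m u r)).
Proof.
move=> hx0 hu.
have meas_u := mx_Lfun_measurable mD hu.
have [a ha] := ae_input_response_bounded.
have [b hb] := mx_Lfuny_ae_bounded hu.
(* The cut-off moves the time integral to the whole line, where Fubini is stated; [g l] is the
   integrable factor and [Phi] the bounded one. *)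
pose g l r := ((fun r => w r * u r l 0) \_ `]0, T[) r.
have ig l : leb.-integrable setT (EFin \o g l).
  rewrite -restrict_EFin; apply/(iffLR (integrable_mkcond _ mD)).
  have := @integrableM_ae_bounded _ _ _ leb `]0, T[ w (fun r => u r l 0) b
    mD iw (meas_u l 0).
  apply => //.
  by apply: filterS hb => r rb rD; exact: rb.
have g0 l r : g l r != 0 -> 0 < r < T.
  rewrite /g patchE; case: ifPn => [/set_mem/=|_]; last by rewrite eqxx.
  by rewrite in_itv.
pose f i (z : S * R) := \sum_l g l z.2 * Phi z.2 z.1 i l.
have fi i : (mu \x leb)%E.-integrable setT (EFin \o f i).
  apply: integrable_sumr => // l.
  apply: (@integrable_prod_bounded _ _ _ _ _ mu leb (g l) _ a) => //.
    exact: measurable_input_response.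
  by apply: filterS ha => s sa r /g0 rT; exact: sa rT i l.
have fE s i j : mx_integral leb `[0, T] (fun r =>
    (T - r) `^ (alpha - 1) *:
      (mittag_leffler alpha alpha ((T - r) `^ alpha *: A s) *m B s *m u r)) i j =
    \int[leb]_r f i (s, r).
  rewrite mx_integral_itv_ccoo; last first.
    move=> k l; under [X in measurable_fun _ X]eq_fun do rewrite mxE.
    apply: measurable_funM; first by apply/measurable_EFinP; exact: measurable_int iw.
    apply: measurable_mulmx => // {}k {}l.
    apply: measurable_funS (measurableT) _ _ => //.
    exact: (measurableT_comp (measurable_input_response k l) (pair1_measurable s)).
  rewrite mxE Rintegral_mkcond; apply: eq_Rintegral => r _.
  rewrite /f/= patchE; case: ifPn => rD; last first.
    by rewrite big1// => l _; rewrite /g patchE (negbTE rD) mul0r.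
  rewrite !mxE mulr_sumr; apply: eq_bigr => l _.
  by rewrite /g patchE rD ord1 -/(Phi r s) mulrCA mulrC.
rewrite /expect /solution mx_integralD//; last 2 first.
- exact: integrable_free_response.
- move=> i j; under eq_fun do rewrite fE.
  exact: integrable_Rintegral.
congr (_ + _); apply/matrixP => i j; rewrite !mxE.
under eq_Rintegral do rewrite fE.
rewrite Rintegral_swap// [RHS]Rintegral_mkcond; apply: eq_Rintegral => r _.
(* Outside ]0, T[ the cut-off makes both sides vanish; inside, every entry of [Phi] is integrable
   over the parameter, so the expectation passes through the sum and the time factors. *)
rewrite /f/= patchE; case: ifPn => rD; last first.
  under eq_Rintegral do
    (rewrite big1; last by move=> l _; rewrite /g patchE (negbTE rD) mul0r).
  by rewrite Rintegral_cst// mul0r.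
have rT : 0 < r < T by move: rD => /set_mem; rewrite /= in_itv.
rewrite Rintegral_sum//; last first.
  by move=> l; apply: integrable_mull => //; exact: integrable_input_response.
rewrite !mxE mulr_sumr; apply: eq_bigr => l _.
rewrite RintegralZl//; last exact: integrable_input_response.
by rewrite /g patchE rD ord1 !mxE mulrCA mulrC.
Qed.

(** * The Gramian, the steering control and the converse *)

Lemma average_gramianE : average_gramian mu alpha T A B =
  mx_integral leb `]0, T[ (fun r => w r *: (K r *m (K r)^T)).
Proof.
rewrite /average_gramian mx_integral_itv_ccoo; last first.
  move=> i j; under [X in measurable_fun _ X]eq_fun do rewrite expect_mul_trmx_response.
  apply: measurable_average_input => k l.
  under [X in measurable_fun _ X]eq_fun do rewrite mxE.
  exact: measurable_funS (measurable_average_response l k).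
by congr mx_integral; apply/funext => r; rewrite expect_mul_trmx_response.
Qed.

(** Three choices of [M] matter: G^-1 times the required displacement for the steering control, the
    identity for the integrability of the Gramian, and v^T for the null direction in the
    converse. *)
Lemma admissible_trmx_average_response (q : nat) (M : 'M[R]_(n, q)) :
  mx_Lfun leb +oo%E `]0, T[ (fun r => (K r)^T *m M).
Proof.
have [a ha] := average_response_bounded.
apply: (@bounded_mx_Lfuny _ _ _ _ _ mD _ _ _
  (n%:R * (a * \big[Num.max/0]_ij `|M ij.1 ij.2|))).
  apply: measurable_mulmx => i j; last exact: measurable_cst.
  under [X in measurable_fun _ X]eq_fun do rewrite mxE.
  exact: measurable_funS (measurable_average_response j i).
move=> r; rewrite /= in_itv/= => rT; apply: mulmx_norm_le => i j.
  by rewrite mxE; exact: ha.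
exact: (le_bigmax _ (fun ij => `|M ij.1 ij.2|) (i, j)).
Qed.

Lemma average_control_steers (x0 : S -> 'cV[R]_n) (x1 : 'cV[R]_n) :
  average_gramian mu alpha T A B \in unitmx -> mx_Lfun mu 1%E setT x0 ->
  admissible_control T (average_control mu alpha T A B x0 x1) /\
  expect mu (fun s =>
    solution alpha A B x0 (average_control mu alpha T A B x0 x1) s T) = x1.
Proof.
move=> uG hx0.
set u := average_control _ _ _ _ _ _ _.
pose e0 := expect mu (fun s => mittag_leffler alpha 1 (T `^ alpha *: A s) *m x0 s).
pose G := average_gramian mu alpha T A B.
have uE : u = fun r => (K r)^T *m (invmx G *m (x1 - e0)).
  apply/funext => r.
  by rewrite /u /average_control expect_mul_trmx_response mulmxA.
have hu : admissible_control T u by rewrite uE; exact: admissible_trmx_average_response.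
split=> //; rewrite expect_solution// -/e0 uE.
under [X in mx_integral _ _ X]eq_fun do rewrite mulmxA scalemxAl.
rewrite mx_integral_mulr//; last first.
  apply: integrable_average_input.
  have := admissible_trmx_average_response 1%:M.
  by under [X in mx_Lfun _ _ _ X]eq_fun do rewrite mulmx1.
by rewrite -average_gramianE mulmxA mulmxV// mul1mx addrC subrK.
Qed.

Lemma controllable_average_gramian_unit :
  exactly_controllable_in_average mu alpha T A B ->
  average_gramian mu alpha T A B \in unitmx.
Proof.
move=> ctrl; rewrite unitmxE unitfE; apply/negP => /det0P[v v0 vG].
have hx0 : mx_Lfun mu 1%E setT (fun=> 0 : 'cV[R]_n).
  move=> i j; rewrite patch_setT; under eq_fun do rewrite mxE.
  exact: Lfun_cst.
(* Starting from zero with target v^T removes the free response, and pairing the reached state with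
   [v] gives |v|^2. *)
have [u hu] := ctrl _ v^T hx0; rewrite expect_solution//.
under [X in expect _ X]eq_fun do rewrite mulmx0.
rewrite (_ : expect mu (fun=> 0) = 0) ?add0r; last first.
  apply/matrixP => i j; rewrite [LHS]mxE [RHS]mxE -[RHS](mul0r (fine (mu setT))).
  by rewrite -Rintegral_cst//; apply: eq_Rintegral => s _; rewrite mxE.
move=> uE.
have hK : mx_Lfun leb +oo%E `]0, T[ (fun r => (K r)^T *m v^T).
  exact: admissible_trmx_average_response.
pose h r := w r * \sum_k (v *m K r) 0 k ^+ 2.
have h0 r : 0 <= h r.
  by rewrite mulr_ge0 ?powR_ge0// sumr_ge0// => k _; rewrite sqr_ge0.
have hE r : (v *m (w r *: (K r *m ((K r)^T *m v^T)))) 0 0 = h r.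
  rewrite -scalemxAr (mulmxA v) -trmx_mul mxE mxE; congr (_ * _).
  by apply: eq_bigr => k _; rewrite [(_^T) _ _]mxE -expr2.
have ih : leb.-integrable `]0, T[ (fun r => (h r)%:E).
  rewrite (_ : (fun r => _) =
    fun r => ((v *m (w r *: (K r *m ((K r)^T *m v^T)))) 0 0)%:E).
    exact: mx_integrable_mull (integrable_average_input hK) 0 0.
  by apply/funext => r; rewrite hE.
(* This integral is the quadratic form v G v^T, which is zero because v G = 0. *)
have int_h : \int[leb]_(r in `]0, T[) h r = 0.
  have /(congr1 (fun M : 'M[R]_(1, n) => (M *m v^T) 0 0)) := vG.
  rewrite mul0mx [RHS]mxE average_gramianE -mulmxA -mx_integral_mulr//; last first.
    apply: integrable_average_input.
    have := admissible_trmx_average_response 1%:M.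
    by under [X in mx_Lfun _ _ _ X]eq_fun do rewrite mulmx1.
  have iKv : mx_integrable leb `]0, T[ (fun r => w r *: (K r *m (K r)^T) *m v^T).
    under [X in mx_integrable _ _ X]eq_fun do rewrite -scalemxAl -mulmxA.
    exact: integrable_average_input.
  rewrite -mx_integral_mull// mxE => ii.
  rewrite -[RHS]ii; apply: eq_Rintegral => r _.
  by rewrite -hE (mulmxA (K r)) scalemxAl.
have vK0 : {ae leb, forall r, `]0, T[%classic r -> forall k, (v *m K r) 0 k = 0}.
  have mh : measurable_fun `]0, T[ (fun r => (h r)%:E) by exact: measurable_int ih.
  have /(ae_eq_integral_abs leb mD mh) : (\int[leb]_(r in `]0%R, T[) `|(h r)%:E| = 0)%E.
    under eq_integral do rewrite gee0_abs ?lee_fin//.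
    have := congr1 EFin int_h; rewrite /Rintegral fineK//.
    exact: integrable_fin_num ih.
  (* For r < T the weight is strictly positive and can be divided out, leaving a vanishing sum of
     squares, hence each component of v K vanishes. *)
  move=> aeh; apply: filterS aeh => r /[swap] rD /(_ rD)[/eqP].
  rewrite mulf_eq0 gt_eqF/=; last first.
    by move: rD; rewrite /= in_itv/= => /andP[_ rT]; rewrite powR_gt0// subr_gt0.
  rewrite psumr_eq0; last by move=> k _; rewrite sqr_ge0.
  by move=> /allP vK k; have /= := vK k (mem_index_enum _); rewrite sqrf_eq0 => /eqP.
have iKu := integrable_average_input hu.
(* Rewriting v^T as the reached state turns |v|^2 into the integral of w (v K) u, whose integrand is
   zero almost everywhere. *)
have : (v *m v^T) 0 0 = 0.
  rewrite -uE -mx_integral_mull// mxE -[RHS]/(fine 0%E) -(@integral0 _ _ _ leb `]0, T[).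
  congr fine; apply: ae_eq_integral => //.
    exact: measurable_int (mx_integrable_mull mD v iKu 0 0).
  suff : {ae leb, forall r, `]0, T[%classic r ->
      ((v *m (w r *: (K r *m u r))) 0 0)%:E = 0%E} by [].
  apply: (@filterS _ _ (ae_filter_ringOfSetsType leb) _ _ _ vK0) => r vK rD.
  rewrite -scalemxAr (mulmxA v) [X in X%:E]mxE [X in _ * X]mxE.
  by rewrite big1 ?mulr0// => k _; rewrite vK// mul0r.
rewrite mxE => /eqP; rewrite psumr_eq0; last first.
  by move=> k _; rewrite mxE -expr2 sqr_ge0.
move=> /allP vv; case/eqP: v0; apply/rowP => k; rewrite mxE; apply/eqP.
by have := vv k (mem_index_enum _); rewrite mxE -expr2 sqrf_eq0.
Qed.

End average_control_system.

Theorem theorem4p27 (d : measure_display) (S : measurableType d) (R : realType)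
    (mu : probability S R) (n m : nat) (alpha T : R)
    (A : S -> 'M[R]_n) (B : S -> 'M[R]_(n, m))
    (hn : (0 < n)%N) (hm : (0 < m)%N)
    (halpha0 : 0 < alpha) (halpha1 : alpha < 1) (hT : 0 < T)
    (hA : mx_Lfun mu +oo%E setT A) (hB : mx_Lfun mu +oo%E setT B) :
  (exactly_controllable_in_average mu alpha T A B <->
     average_gramian mu alpha T A B \in unitmx) /\
  (average_gramian mu alpha T A B \in unitmx ->
   forall (x0 : S -> 'cV[R]_n) (x1 : 'cV[R]_n), mx_Lfun mu 1%E setT x0 ->
     admissible_control T (average_control mu alpha T A B x0 x1) /\
     expect mu (fun s =>
       solution alpha A B x0 (average_control mu alpha T A B x0 x1) s T) = x1).
Proof.
have steers := average_control_steers halpha0 hT hA hB.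
split; last by move=> uG x0 x1 hx0; exact: steers.
split; first exact: controllable_average_gramian_unit.
move=> uG x0 x1 hx0; exists (average_control mu alpha T A B x0 x1).
  by have [] := steers x0 x1 uG hx0.
by have [] := steers x0 x1 uG hx0.
Qed.
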